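(* For $N\ge1$, \[\overline{Z_N}(\{u\}_N|\{w\}_N)=\frac{\prod_{j=1}^N(1-t)dw_j\prod_{j,k=1}^N(atu_j+bw_k)(eu_j+tfw_k)}{(t^2cd)^{N(N-1)/2}\prod_{1\le j<k\le N}(u_j-u_k)(w_k-w_j)}\det_{1\le j,k\le N}\Big(\frac{1}{(atu_j+bw_k)(eu_j+tfw_k)}\Big).\]
   Context: Fix complex parameters $t,a,b,c,d,e,f$, all nonzero, with $t\neq1$, satisfying $cd+af=0$ and $tcd+be=0$. The inhomogeneous $L$-operator $L_{aj}(u,w)$ on $W_a\otimes V_j$ ($\cong\mathbb{C}^2\otimes\mathbb{C}^2$, basis $|0\rangle,|1\rangle$) has matrix elements ${}_a\langle\gamma|{}_j\langle\delta|L_{aj}(u,w)|\alpha\rangle_a|\beta\rangle_j=[L(u,w)]^{\gamma\delta}_{\alpha\beta}$: $[L]^{00}_{00}=au+bw$, $[L]^{01}_{01}=atu+bw$, $[L]^{01}_{10}=(1-t)cu$, $[L]^{10}_{01}=(1-t)dw$, $[L]^{10}_{10}=eu+fw$, $[L]^{11}_{11}=eu+tfw$, all others $0$. Define $C_N(u|\{w\}_N)={}_a\langle1|L_{aN}(u,w_N)\cdots L_{a1}(u,w_1)|0\rangle_a$ on $V_1\otimes\cdots\otimes V_N$ and $\overline{Z_N}(\{u\}_N|\{w\}_N)=\langle\Omega|C_N(u_N|\{w\}_N)\cdots C_N(u_1|\{w\}_N)|1\cdots N\rangle$ with $\langle\Omega|=\langle0|^{\otimes N}$, $|1\cdots N\rangle=|1\rangle^{\otimes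 N}$. *)

(* Defs.v *)
From HB Require Import structures.
From mathcomp Require Import all_boot all_order all_algebra.
Set Implicit Arguments. Unset Strict Implicit. Unset Printing Implicit Defensive.
Import Order.TTheory GRing.Theory Num.Theory.
Local Open Scope ring_scope.

Section Model.
Variables (R : fieldType) (t a b c d e f : R).

(* Basis |0> = false, |1> = true.
   Lentry u w g dl al be = [L(u,w)]^{g dl}_{al be}, i.e.
   <g|_a <dl|_j L_{aj}(u,w) |al>_a |be>_j. *)
Definition Lentry (u w : R) (g dl al be : bool) : R :=
  match g, dl, al, be with
  | false, false, false, false => a * u + b * w
  | false, true,  false, true  => a * t * u + b * w
  | false, true,  true,  false => (1 - t) * c * u
  | true,  false, false, true  => (1 - t) * d * w
  | true,  false, true,  false => e * u + f * w
  | true,  true,  true,  true  => e * u + t * f * w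
  | _, _, _, _ => 0
  end.

(* Matrix element <outs| (<1|_a L_{a n}(u,w_n) ... L_{a 1}(u,w_1) |al>_a) |ins>
   where ws, outs, ins are listed from site 1 to site n; the auxiliary
   space enters site 1 in state al and must leave the last site in state 1. *)
Fixpoint Cel (u : R) (ws : seq R) (outs ins : seq bool) (al : bool) : R :=
  match ws, outs, ins with
  | w :: ws', o :: outs', i :: ins' =>
      \sum_(g : bool) Lentry u w g o al i * Cel u ws' outs' ins' g
  | [::], [::], [::] => if al then 1 else 0
  | _, _, _ => 0
  end.

Definition Cmat (N : nat) (u : R) (w : 'I_N -> R) (out inp : N.-tuple bool) : R :=
  Cel u [seq w i | i <- enum 'I_N] out inp false.

(* Components of C_N(v_1) ... C_N(v_k) |1...1>, for the list [:: v_1; ...; v_k]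
   (so the last element of the list acts first). *)
Fixpoint Cvec (N : nat) (w : 'I_N -> R) (us : seq R) (s : N.-tuple bool) : R :=
  match us with
  | [::] => if val s == nseq N true then 1 else 0
  | u :: us' => \sum_(s' : N.-tuple bool) @Cmat N u w s s' * @Cvec N w us' s'
  end.

(* \overline{Z_N}({u}_N | {w}_N) = <Omega| C_N(u_N) ... C_N(u_1) |1...N> *)
Definition ZN (N : nat) (u w : 'I_N -> R) : R :=
  @Cvec N w (rev [seq u i | i <- enum 'I_N]) (nseq_tuple N false).

End Model.

(* Main.v *)
(* After a diagonal change of basis at each site, which only extracts the factor
   [\prod_k w k] from Z_N, the partition function is symmetric in the u_j (the
   C-operators commute, by the RTT relation) and is a polynomial of degree < N
   in w_1. At [a t u_j + b w_1 = 0] the first site freezes and Z_N reduces to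
   Z_(N-1) without u_j and w_1. Multiplied by [\prod_(k > 1) (w_k - w_1)], both
   sides of the formula, with the determinant expanded along its first column,
   are polynomials of degree at most 2N - 2 in w_1. They agree at the N points
   [- a t u_j / b] by induction on N, and both vanish at the N - 1 points w_k,
   k > 1, where two columns of the matrix coincide. *)

Require Import Defs.
From HB Require Import structures.
From mathcomp Require Import all_boot all_order all_algebra.
From mathcomp Require Import ring.
Set Implicit Arguments. Unset Strict Implicit. Unset Printing Implicit Defensive.
Import GRing.Theory.
Local Open Scope ring_scope.

(** * Bit strings as an explicit index list *)

Fixpoint bits (n : nat) : seq (seq bool) :=
  if n is m.+1 then map (cons false) (bits m) ++ map (cons true) (bits m)
  else [:: [::]].

Lemma mem_bits n s : (s \in bits n) = (size s == n).
Proof.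
elim: n s => [|n IH] [|x s] //=; rewrite mem_cat.
  by apply/negbTE/norP; split; apply/negP => /mapP[].
rewrite eqSS -IH; apply/orP/idP => [[]/mapP[s' h [_ ->]]//|h].
by case: x; [right|left]; apply: map_f.
Qed.

Lemma bits_uniq n : uniq (bits n).
Proof.
elim: n => //= n IH; have inj (x : bool) : injective (cons x) by move=> ? ? [].
rewrite cat_uniq !map_inj_uniq // IH andbT /=; apply/hasPn => _ /mapP[s _ ->].
by apply/negP => /mapP[].
Qed.

Lemma big_bitsS (V : nmodType) n (F : seq bool -> V) :
  \sum_(s <- bits n.+1) F s =
  \sum_(s <- bits n) (F (false :: s) + F (true :: s)).
Proof. by rewrite big_cat !big_map big_split. Qed.

(** Trades tuples for plain sequences, on which the inductions over sites run. *)
Lemma big_tuple_bits (V : nmodType) n (F : seq bool -> V) :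
  \sum_(s : n.-tuple bool) F s = \sum_(s <- bits n) F s.
Proof.
rewrite -[LHS](big_map (@tval n bool) xpredT F); apply: perm_big.
apply: uniq_perm; rewrite ?bits_uniq ?map_inj_uniq ?index_enum_uniq //.
  exact: val_inj.
move=> s; rewrite mem_bits; apply/mapP/idP => [[x _ ->]|h].
  by rewrite size_tuple.
by exists (Tuple h); rewrite ?mem_index_enum.
Qed.

(** * The diagonal change of basis *)

Section Gauged.
Variables (R : fieldType) (t a b c d e f : R).

(* [Lentry] with the site vector |0> rescaled by [w]. Without this, Z_N would
   vanish at w_1 = 0, which coincides with the interpolation point
   [- a t u_j / b] when [u j = 0]. *)
Definition Lred (u w : R) (g dl al be : bool) : R :=
  match g, dl, al, be with
  | true,  false, false, true  => (1 - t) * d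
  | false, true,  true,  false => (1 - t) * c * u * w
  | _, _, _, _ => Lentry t a b c d e f u w g dl al be
  end.

Fixpoint Cred (u : R) (ws : seq R) (outs ins : seq bool) (al : bool) : R :=
  match ws, outs, ins with
  | w :: ws', o :: outs', i :: ins' =>
      \sum_(g : bool) Lred u w g o al i * Cred u ws' outs' ins' g
  | [::], [::], [::] => if al then 1 else 0
  | _, _, _ => 0
  end.

Fixpoint Cstate (ws us : seq R) (s : seq bool) : R :=
  match us with
  | [::] => if s == nseq (size ws) true then 1 else 0
  | u :: us' => \sum_(s' <- bits (size ws)) Cred u ws s s' false * Cstate ws us' s'
  end.

Lemma Cstate_cons ws u us s : Cstate ws (u :: us) s =
  \sum_(s' <- bits (size ws)) Cred u ws s s' false * Cstate ws us s'.
Proof. by []. Qed.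

Fixpoint gauge (ws : seq R) (s : seq bool) : R :=
  match ws, s with
  | w :: ws', o :: s' => (if o then 1 else w) * gauge ws' s'
  | _, _ => 1
  end.

(** Conjugation by diag(w, 1) at every site, stated without division so that a vanishing [w] is
    allowed. *)
Lemma Cel_gauge u ws outs ins al :
  Cel t a b c d e f u ws outs ins al * gauge ws ins =
  gauge ws outs * Cred u ws outs ins al.
Proof.
elim: ws outs ins al => [|w ws IH] [|o outs] [|i ins] al //=;
  rewrite ?mul0r ?mulr0 ?mul1r ?mulr1 //.
rewrite mulr_suml mulr_sumr; apply: eq_bigr => g _.
have L_gauge : Lentry t a b c d e f u w g o al i * (if i then 1 else w) =
    (if o then 1 else w) * Lred u w g o al i.
  by case: g; case: o; case: al; case: i => /=; ring.
by rewrite mulrACA L_gauge IH mulrACA.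
Qed.

(** The gauge factors of intermediate states cancel between successive rows, and the all-1 reference
    state has factor 1; only the outgoing factor survives. *)
Lemma Cvec_gauge N (w : 'I_N -> R) us (s : N.-tuple bool) :
  let ws := [seq w i | i <- enum 'I_N] in
  Cvec t a b c d e f w us s = gauge ws s * Cstate ws us s.
Proof.
have szws : size [seq w i | i <- enum 'I_N] = N by rewrite size_map size_enum_ord.
elim: us s => [|u us IH] s /=.
  rewrite szws; case: eqP => [->|_]; last by rewrite mulr0.
  by rewrite mulr1; elim: N {s w szws}[seq _ | _ <- _] => [|N IH] [|x ws] //=; rewrite -IH mulr1.
rewrite szws mulr_sumr -(big_tuple_bits N (fun s' => gauge _ s * (Cred _ _ s s' false * Cstate _ _ s'))).
by apply: eq_bigr => s' _; rewrite IH mulrA Cel_gauge mulrA.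
Qed.

(** * Commutation of the C-operators *)

Definition two_rows u v ws outs ins al be : R :=
  \sum_(s <- bits (size ws)) Cred u ws outs s al * Cred v ws s ins be.

Lemma two_rowsS u v w ws o outs i ins al be :
  two_rows u v (w :: ws) (o :: outs) (i :: ins) al be =
  \sum_(m : bool) \sum_(g : bool) \sum_(h : bool)
    Lred u w g o al m * Lred v w h m be i * two_rows u v ws outs ins g h.
Proof.
rewrite /two_rows big_bitsS !big_bool /= !mulr_sumr -!big_split /=.
by apply: eq_bigr => s _; rewrite !big_bool /=; ring.
Qed.

Hypotheses (t0 : t != 0) (a0 : a != 0) (e0 : e != 0).
Hypotheses (h1 : c * d + a * f = 0) (h2 : t * c * d + b * e = 0).

Lemma f_eq : f = - (c * d) / a.
Proof.
apply/(mulIf a0); rewrite mulfVK //; apply/eqP.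
by rewrite -addr_eq0 mulrC addrC h1.
Qed.

Lemma b_eq : b = - (t * c * d) / e.
Proof.
by apply/(mulIf e0); rewrite mulfVK //; apply/eqP; rewrite -addr_eq0 addrC h2.
Qed.

(* The components of the RTT relation whose outgoing auxiliary pair is
   (1, 1), solved so that only [t (u - v)] has to be inverted: the usual form
   carries the R-matrix weight of (1, 1), which may vanish. *)
Lemma two_rows_exchange u v ws outs ins : u != v ->
  let T := two_rows u v ws outs ins in let T' := two_rows v u ws outs ins in
  [/\ T false false = T' false false, T true true = T' true true,
      T true false =
        ((1 - t) * u * T false true + (t * u - v) * T' false true) / (t * (u - v))
    & T' true false =
        ((1 - t) * v * T' false true + (t * v - u) * T false true) / (t * (v - u))].
Proof.
move=> uv /=; have uv0 : u - v != 0 by rewrite subr_eq0.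
have vu0 : v - u != 0 by rewrite subr_eq0 eq_sym.
elim: ws outs ins => [|w ws IH] [|o outs] [|i ins];
  try by split; rewrite /two_rows !big1 ?mulr0 ?addr0 ?mul0r // => s _;
    case: s => [|? ?] /=; rewrite ?mulr0 ?mul0r.
  by rewrite /two_rows /= !big_seq1 /= !(mul0r, mulr0, addr0).
(* The induction hypothesis expresses all terms through [T' false false], [T' true true],
   [T false true] and [T' false true]; what remains are identities between the weights of one
   site. *)
rewrite !two_rowsS !big_bool; case: (IH outs ins) => {IH} -> -> -> ->.
by case: o; case: i; split; rewrite /Lred /Lentry /= ?f_eq ?b_eq; field; rewrite ?t0 ?a0 ?e0 ?uv0 ?vu0.
Qed.

(** The [false false] component of the exchange relations is the commutation of C(u) and C(v). *)
Lemma Cstate_swap ws u v us s :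
  Cstate ws (u :: v :: us) s = Cstate ws (v :: u :: us) s.
Proof.
have [->//|uv] := eqVneq u v.
have two p q : Cstate ws (p :: q :: us) s =
    \sum_(s' <- bits (size ws)) two_rows p q ws s s' false false * Cstate ws us s'.
  rewrite /=; under eq_bigr do rewrite mulr_sumr.
  rewrite exchange_big; apply: eq_bigr => s' _; rewrite mulr_suml.
  by apply: eq_bigr => s'' _; rewrite mulrA.
rewrite !two; apply: eq_bigr => s' _.
by case: (two_rows_exchange ws s s' uv) => ->.
Qed.

Lemma Cstate_perm ws us vs s : perm_eq us vs -> Cstate ws us s = Cstate ws vs s.
Proof.
have move_front u vs1 vs2 s' :
    Cstate ws (vs1 ++ u :: vs2) s' = Cstate ws (u :: vs1 ++ vs2) s'.
  elim: vs1 s' => // v vs1 IH s'; rewrite [RHS]Cstate_swap.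
  by apply: eq_bigr => s'' _; congr (_ * _); apply: IH.
elim: us vs s => [|u us IH] vs s us_vs.
  by have /eqP := perm_size us_vs; rewrite eq_sym => /nilP ->.
have: u \in vs by rewrite -(perm_mem us_vs) mem_head.
move=> u_vs; case/splitPr: u_vs us_vs => vs1 vs2.
rewrite (perm_sym _ (_ ++ _)) -cat1s perm_catCA perm_cons perm_sym => us_vs.
by rewrite move_front; apply: eq_bigr => s' _; congr (_ * _); apply: IH.
Qed.

(** * Dependence on the first site *)

(** The auxiliary line enters in state 0, so no row can turn the first site from 0 to 1: it was in
    state 1 throughout. *)
Lemma Cstate_true w ws us s :
  Cstate (w :: ws) us (true :: s) =
  \prod_(u <- us) (a * t * u + b * w) * Cstate ws us s.
Proof.
elim: us s => [|u us IH] s; first by rewrite big_nil mul1r /= eqseq_cons.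
rewrite big_cons !Cstate_cons big_bitsS mulr_sumr; apply: eq_bigr => s' _.
by rewrite IH /= !big_bool /=; ring.
Qed.

(* A polynomial in the spectral parameter of the first site, which is flipped. *)
Fixpoint flip_poly (ws us : seq R) (s : seq bool) : {poly R} :=
  match us with
  | [::] => 0
  | u :: us' => \sum_(s' <- bits (size ws))
      ((b *: 'X + (a * u)%:P) * ((Cred u ws s s' false)%:P * flip_poly ws us' s') +
       \prod_(v <- us') (b *: 'X + (a * t * v)%:P) *
         ((1 - t) * d * Cred u ws s s' true * Cstate ws us' s')%:P)
  end.

(** The row acting last either finds the first site already in state 0, or flips it; in the latter
    case [Cstate_true] gives the weights of all earlier rows. *)
Lemma flip_polyE w ws us s :
  (flip_poly ws us s).[w] = Cstate (w :: ws) us (false :: s).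
Proof.
elim: us s => [|u us IH] s; first by rewrite horner0.
rewrite Cstate_cons big_bitsS /= horner_sum; apply: eq_bigr => s' _.
have prodE : \prod_(v <- us) (b *: 'X + (a * t * v)%:P).[w] =
    \prod_(v <- us) (a * t * v + b * w).
  by apply: eq_bigr => v _; rewrite !hornerE addrC.
by rewrite Cstate_true !big_bool /= !(hornerD, hornerM, hornerC, hornerZ, hornerX) IH horner_prod prodE; ring.
Qed.

Lemma size_linear (x y : R) : (size (x *: 'X + y%:P)%R <= 2)%N.
Proof.
rewrite -mul_polyC -[_ * 'X + _]cons_poly_def size_cons_poly.
by case: ifP => // _; apply: (leq_ltn_trans (size_polyC_leq1 _)).
Qed.

Lemma size_prod_linear (I : Type) (r : seq I) (p : I -> {poly R}) :
  (forall i, (size (p i) <= 2)%N) -> (size (\prod_(i <- r) p i)%R <= (size r).+1)%N.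
Proof.
move=> sp; elim: r => [|i r IH]; first by rewrite big_nil size_poly1.
rewrite big_cons; apply: leq_trans (size_polyMleq _ _) _.
by have := leq_add (sp i) IH; case: (_ + _)%N.
Qed.

Lemma size_polyM_const (p : {poly R}) x : (size (p * x%:P)%R <= size p)%N.
Proof. by rewrite mulrC mul_polyC size_scale_leq. Qed.

(** Thanks to the gauge, the row that flips the first site contributes a constant in its spectral
    parameter; every other row is linear. *)
Lemma size_flip_poly ws us s : (size (flip_poly ws us s) <= size us)%N.
Proof.
elim: us s => [|u us IH] s; first by rewrite size_poly0.
apply: (leq_trans (size_sum _ _ _)); apply/bigmax_leqP_seq => s' _ _.
apply: leq_trans (size_polyD _ _) _; rewrite geq_max; apply/andP; split.
  apply: leq_trans (size_polyMleq _ _) _; rewrite mul_polyC.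
  have := leq_add (size_linear b (a * u)) (leq_trans (size_scale_leq (Cred u ws s s' false) _) (IH s')).
  by case: (_ + _)%N.
apply: leq_trans (size_polyM_const _ _) _.
by apply: size_prod_linear => v; apply: size_linear.
Qed.

Lemma Cred_true_nseq u ws s :
  Cred u ws s (nseq (size ws) true) true =
  if s == nseq (size ws) true then \prod_(w <- ws) (e * u + t * f * w) else 0.
Proof.
elim: ws s => [|w ws IH] [|o s] //=; first by rewrite big_nil.
rewrite big_bool eqseq_cons big_cons IH.
case: o => /=; last by rewrite !mul0r addr0.
by case: ifP; rewrite ?mulr0 ?mul0r addr0.
Qed.

(* At a zero of the b-type weight of the row acting first and the first site,
   the flip of that site is forced to happen in that row. *)
Lemma Cstate_frozen w ws us v s : a * t * v + b * w = 0 ->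
  Cstate (w :: ws) (rcons us v) (false :: s) =
  (1 - t) * d * \prod_(w' <- ws) (e * v + t * f * w') *
  \prod_(u <- us) (a * u + b * w) * Cstate ws us s.
Proof.
move=> v0; elim: us s => [|u us IH] s.
  rewrite big_nil mulr1 Cstate_cons big_bitsS /=.
  rewrite (eq_bigr (fun s' => if s' == nseq (size ws) true then
    (1 - t) * d * Cred v ws s (nseq (size ws) true) true else 0)); last first.
    move=> s' _; rewrite !big_bool /= !eqseq_cons /=; case: eqP => [->|_]; ring.
  rewrite -big_mkcond /= (big_rem (nseq (size ws) true)) ?mem_bits ?size_nseq //=.
  rewrite eqxx big1_seq ?addr0 => [|s' /andP[/eqP ->]]; last first.
    by rewrite mem_rem_uniqF ?bits_uniq.
  by rewrite Cred_true_nseq; case: ifP; rewrite ?mulr1 ?mulr0.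
rewrite !Cstate_cons big_bitsS big_cons mulr_sumr; apply: eq_bigr => s' _.
rewrite Cstate_true IH /= !big_bool /=.
(* If the row of [u] did the flip, the row of [v] would keep the first site in state 1, with weight
   zero. *)
rewrite (_ : \prod_(u <- rcons us v) (a * t * u + b * w) = 0); first by ring.
by rewrite big_rcons v0 /= ?mul0r ?mulr0.
Qed.

(** * Vandermonde products and the determinant *)

Definition vdm n (x : 'I_n -> R) : R :=
  \prod_(i < n) \prod_(k < n | (i < k)%N) (x i - x k).

(** The sign comes from the [j] pairs [(l, j)] with [l < j], whose factors get reversed. *)
Lemma vdm_lift n (x : 'I_n.+1 -> R) (j : 'I_n.+1) :
  vdm x = (-1) ^+ j * \prod_l (x j - x (lift j l)) * vdm (x \o lift j).
Proof.
rewrite /vdm (bigD1_ord j) //= big_mkcond (bigD1_ord j) //= ltnn mul1r.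
under [X in _ * X = _]eq_bigr do rewrite big_mkcond (bigD1_ord j) //= -big_mkcond /=.
rewrite big_split /= mulrA -big_split /=; congr (_ * _); last first.
  by apply: eq_bigr => i _; apply: eq_bigl => k; rewrite !ltnNge leq_bump2.
have jn : (j <= n)%N by rewrite -ltnS.
have <- : \prod_(l < n) (if (l < j)%N then -1 else 1 : R) = (-1) ^+ j.
  by rewrite -big_mkcond (big_ord_narrow jn) prodr_const card_ord.
rewrite -big_split; apply: eq_bigr => l _ /=; rewrite /bump.
case: (leqP j l) => lj.
  by rewrite add1n ltnS lj ltnNge (leqW lj) mulr1 mul1r.
by rewrite add0n lj ltnNge (ltnW lj) /=; ring.
Qed.

Lemma vdm_neq0 n (x : 'I_n -> R) : injective x -> vdm x != 0.
Proof.
move=> injx; apply/prodf_neq0 => i _; apply/prodf_neq0 => k ik.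
by rewrite subr_eq0 (inj_eq injx) neq_ltn ik.
Qed.

Let BA (x y : R) := (a * t * x + b * y) * (e * x + t * f * y).

Let detBA n (u w : 'I_n -> R) := \det (\matrix_(i, k) (BA (u i) (w k))^-1).

(** The left side has no denominator in [w ord0], so it makes sense as a polynomial even at zeros of
    [BA]. *)
Lemma det_expand_first n (u : 'I_n.+1 -> R) (w : 'I_n.+1 -> R) :
  (forall i, BA (u i) (w ord0) != 0) ->
  \sum_(i < n.+1) (-1) ^+ i * detBA (u \o lift i) (w \o lift ord0) *
     \prod_l BA (u (lift i l)) (w ord0) =
  \prod_i BA (u i) (w ord0) * detBA u w.
Proof.
move=> BA0; rewrite [in RHS]/detBA (expand_det_col _ ord0) mulr_sumr.
apply: eq_bigr => i _; rewrite (bigD1_ord i) //= mxE /cofactor addn0.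
have -> : row' i (col' ord0 (\matrix_(i, k) (BA (u i) (w k))^-1)) =
   \matrix_(l, k) (BA (u (lift i l)) (w (lift ord0 k)))^-1.
  by apply/matrixP => l k; rewrite !mxE.
by rewrite /detBA /=; field.
Qed.

(** Serves to make the row of any [u j] act first, as freezing requires. *)
Lemma perm_rcons_lift n (u : 'I_n.+1 -> R) (j : 'I_n.+1) :
  perm_eq (rev [seq u i | i <- enum 'I_n.+1])
          (rcons (rev [seq u (lift j i) | i <- enum 'I_n]) (u j)).
Proof.
rewrite perm_rev perm_sym perm_rcons.
have -> : [seq u (lift j i) | i <- enum 'I_n] = map u (map (lift j) (enum 'I_n)).
  by rewrite -map_comp.
rewrite -map_rev -map_cons; apply: perm_map; apply: uniq_perm.
- rewrite /= mem_rev rev_uniq map_inj_uniq ?enum_uniq ?andbT; last exact: lift_inj.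
  by apply/mapP => -[k _] /eqP; rewrite (negbTE (neq_lift j k)).
- exact: enum_uniq.
move=> k; rewrite mem_enum inE mem_rev; case: (unliftP j k) => [l ->|->]; last by rewrite eqxx.
by rewrite map_f ?orbT ?mem_enum.
Qed.

(** * Interpolation in the first spectral parameter *)

Hypotheses (b0 : b != 0) (c0 : c != 0) (d0 : d != 0).

Let Zred n (u w : 'I_n -> R) :=
  Cstate [seq w i | i <- enum 'I_n] (rev [seq u i | i <- enum 'I_n]) (nseq n false).

(** Negation gives [vdm] the factors [w k - w j] for [j < k]. *)
Let opp_fun n (w : 'I_n -> R) := fun k => - w k.

Lemma Zred_det n (u w : 'I_n -> R) : injective u -> injective w ->
  (forall j k, a * t * u j + b * w k != 0) ->
  (forall j k, e * u j + t * f * w k != 0) ->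
  Zred u w * ((t ^+ 2 * c * d) ^+ (n * n.-1)./2 * (vdm u * vdm (opp_fun w))) =
  ((1 - t) * d) ^+ n * \prod_j \prod_k BA (u j) (w k) * detBA u w.
Proof.
elim: n u w => [|n IH] u w inju injw B0 A0.
  by rewrite /Zred /vdm !big_ord0 /detBA det_mx00 (size0nil (size_enum_ord 0)) !expr0 !mulr1.
have BA0 i k : BA (u i) (w k) != 0 by rewrite mulf_neq0.
pose wp := w \o lift ord0.
pose ws := [seq wp i | i <- enum 'I_n].
pose us := rev [seq u i | i <- enum 'I_n.+1].
pose Q := t ^+ 2 * c * d.
pose p := flip_poly ws us (nseq n false).
pose X j := - (a * t * u j) / b.
have BX j : a * t * u j + b * X j = 0 by rewrite /X; field.
have binQ : (n.+1 * n)./2 = (n + (n * n.-1)./2)%N.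
  by rewrite -[n in (_ * n)./2]/(n.+1.-1) -!bin2 binS bin1 addnC.
(* [K1] and [K2] collect the factors free of w_1; [P1] and [P2] are the two sides as polynomials in
   w_1. *)
pose K1 := Q ^+ (n.+1 * n)./2 * (vdm u * vdm (opp_fun wp)).
pose K2 := ((1 - t) * d) ^+ n.+1 * \prod_i \prod_k BA (u i) (wp k).
pose P1 := p * \prod_(k < n) (-1 *: 'X + (wp k)%:P) * K1%:P.
pose P2 := (\sum_(i < n.+1) (\prod_l ((b *: 'X + (a * t * u (lift i l))%:P) *
    ((t * f) *: 'X + (e * u (lift i l))%:P))) *
  ((-1) ^+ i * detBA (u \o lift i) wp)%:P) * K2%:P.
have P1E y : P1.[y] = Cstate (y :: ws) us (nseq n.+1 false) *
    \prod_(k < n) (wp k - y) * K1.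
  rewrite !(hornerD, hornerM, hornerC, hornerZ, hornerX, hornerN) flip_polyE horner_prod; congr (_ * _ * _).
  by apply: eq_bigr => k _; rewrite !(hornerD, hornerM, hornerC, hornerZ, hornerX, hornerN); ring.
have P2E y : P2.[y] = (\sum_(i < n.+1) (-1) ^+ i * detBA (u \o lift i) wp *
     \prod_l BA (u (lift i l)) y) * K2.
  rewrite !(hornerD, hornerM, hornerC, hornerZ, hornerX, hornerN) horner_sum; congr (_ * _); apply: eq_bigr => i _.
  rewrite !(hornerD, hornerM, hornerC, hornerZ, hornerX, hornerN) horner_prod mulrC; congr (_ * _); apply: eq_bigr => l _.
  by rewrite !(hornerD, hornerM, hornerC, hornerZ, hornerX, hornerN) /BA; congr (_ * _); rewrite addrC.
have P2_site y : (forall i, BA (u i) y != 0) ->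
    P2.[y] = \prod_i BA (u i) y *
      detBA u (fun k => if unlift ord0 k is Some k' then wp k' else y) * K2.
  move=> y0; rewrite P2E; congr (_ * _).
  have := @det_expand_first n u (fun k => if unlift ord0 k is Some k' then wp k' else y).
  rewrite unlift_none => /(_ y0) <-; apply: eq_bigr => i _; congr (_ * _ * _).
  by congr (\det _); apply/matrixP => l k; rewrite !mxE /= liftK.
have P12_w k : P1.[wp k] = P2.[wp k].
  rewrite P1E P2_site => [|i]; last exact: BA0.
  rewrite (bigD1 k) //= subrr mul0r mulr0 mul0r.
  rewrite /detBA -det_tr (determinant_alternate (neq_lift ord0 k)) ?mulr0 ?mul0r // => i.
  by rewrite !mxE unlift_none liftK.
have P12_X j : P1.[X j] = P2.[X j].
  have P2X : P2.[X j] = (-1) ^+ j * detBA (u \o lift j) wp *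
      \prod_l BA (u (lift j l)) (X j) * K2.
    (* Only the summand [i = j] omits the row [u j]; all others contain the factor
       [BA (u j) (X j) = 0]. *)
    rewrite P2E (bigD1 j) //= [X in _ + X]big1 ?addr0 // => i ij.
    have [l jl|ji] := unliftP i j; last by rewrite ji eqxx in ij.
    by rewrite (bigD1 l) //= -jl /BA BX mul0r mul0r mulr0.
  rewrite P1E P2X (Cstate_perm _ _ (perm_rcons_lift u j)) (Cstate_frozen _ _ _ (BX j)).
  have := IH (u \o lift j) wp; set Zj := Zred _ _ => IHj.
  have {}IHj := IHj (inj_comp inju (@lift_inj _ j)) (inj_comp injw (@lift_inj _ ord0))
    (fun _ _ => B0 _ _) (fun _ _ => A0 _ _).
  have wsE F : \prod_(y <- ws) F y = \prod_k F (wp k) :> R by rewrite big_map big_enum.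
  have usE F : \prod_(x <- rev [seq u (lift j i) | i <- enum 'I_n]) F x =
      \prod_l F (u (lift j l)) :> R.
    by rewrite (perm_big _ (permEl (perm_rev _))) big_map big_enum.
  rewrite wsE usE.
  rewrite -[Cstate _ _ _]/Zj /K1 /K2 (vdm_lift u j) (bigD1_ord j) //= exprS binQ exprD.
  rewrite [\prod_k BA (u j) (wp k)]big_split /=.
  have FW : \prod_k (wp k - X j) * b ^+ n = \prod_k (a * t * u j + b * wp k).
    rewrite -[n in b ^+ n]card_ord -prodr_const -big_split.
    by apply: eq_bigr => k _ /=; rewrite /X; field.
  (* By the constraints on the parameters, [a * x + b * X j] and [e * x + t * f * X j] are
     proportional, both vanishing at [x = t * u j]; each remaining row absorbs one factor [Q]. *)
  have FU : \prod_l (a * u (lift j l) + b * X j) *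
      \prod_l (u j - u (lift j l)) * Q ^+ n = b ^+ n * \prod_l BA (u (lift j l)) (X j).
    rewrite -[n in Q ^+ n]card_ord -[n in b ^+ n]card_ord -!prodr_const -!big_split.
    apply: eq_bigr => l _ /=; rewrite /X /BA /Q f_eq b_eq; field.
    by rewrite e0 a0 oppr_eq0 !mulf_neq0.
  transitivity ((1 - t) * d * (-1) ^+ j * \prod_k (e * u j + t * f * wp k) *
    (\prod_l (a * u (lift j l) + b * X j) * \prod_l (u j - u (lift j l)) * Q ^+ n) *
    \prod_k (wp k - X j) *
    (Zj * (Q ^+ (n * n.-1)./2 * (vdm (u \o lift j) * vdm (opp_fun wp))))); first by ring.
  by rewrite FU IHj -FW; ring.
have szI : size (index_enum 'I_n) = n by rewrite -sum1_size sum1_card card_ord.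
(* The size is the degree plus one, so the bound is exactly the number of nodes. *)
have sz : (size (P1 - P2)%R <= n + n.+1)%N.
  apply: leq_trans (size_polyD _ _) _; rewrite size_polyN geq_max; apply/andP; split.
    apply: leq_trans (size_polyM_const _ _) _.
    apply: leq_trans (size_polyMleq _ _) _.
    have := leq_add (size_flip_poly ws us (nseq n false))
      (size_prod_linear (index_enum 'I_n) (fun k => size_linear (-1) (wp k))).
    rewrite size_rev size_map size_enum_ord szI.
    by rewrite -/p addSn addnS; case: (_ + _)%N.
  apply: leq_trans (size_polyM_const _ _) _.
  apply: (leq_trans (size_sum _ _ _)); apply/bigmax_leqP => i _.
  apply: leq_trans (size_polyM_const _ _) _; rewrite big_split.
  apply: leq_trans (size_polyMleq _ _) _.
  have := leq_add
    (size_prod_linear (index_enum 'I_n) (fun l => size_linear b (a * t * u (lift i l))))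
    (size_prod_linear (index_enum 'I_n) (fun l => size_linear (t * f) (e * u (lift i l)))).
  by rewrite szI !addSn addnS; case: (_ + _)%N.
have injwp : injective wp := inj_comp injw (@lift_inj _ ord0).
have injX : injective X.
  move=> i j /(mulIf (invr_neq0 b0)) /oppr_inj.
  by move/(mulfI (mulf_neq0 a0 t0)) => /inju.
have P12 : P1 = P2.
  apply/eqP; rewrite -subr_eq0; apply/eqP.
  apply: (@roots_geq_poly_eq0 _ _ (map wp (enum 'I_n) ++ map X (enum 'I_n.+1))).
  - by apply/allP => y; rewrite mem_cat => /orP[] /mapP[i _ ->];
      rewrite rootE hornerD hornerN ?P12_w ?P12_X subrr.
  - rewrite cat_uniq (map_inj_uniq injwp) (map_inj_uniq injX) !enum_uniq andbT /=.
    (* A coincidence of [X j] with some [wp k] would make [a * t * u j + b * wp k] vanish, against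
       [B0]. *)
    apply/hasPn => _ /mapP[j _ ->]; apply/negP => /mapP[k _ Xw].
    by have := B0 j (lift ord0 k); rewrite -[w _]/(wp k) -Xw BX eqxx.
  - by rewrite size_cat (size_map wp) (size_map X) !size_enum_ord.
have ZE : Zred u w = Cstate (w ord0 :: ws) us (nseq n.+1 false).
  have wsE : [seq w i | i <- enum 'I_n.+1] = w ord0 :: ws.
    by rewrite enum_ordSl /= -map_comp.
  by rewrite /Zred wsE.
have detE : detBA u (fun k => if unlift ord0 k is Some k' then wp k' else w ord0) = detBA u w.
  congr (\det _); apply/matrixP => i k; rewrite !mxE.
  by case: unliftP => [k' ->|->].
(* At the actual w_1 no [BA] vanishes, so [P2] can be read as the determinant again. *)
have := congr1 (horner^~ (w ord0)) P12; rewrite /= P1E P2_site // detE -ZE.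
rewrite /K1 /K2 (vdm_lift (opp_fun w) ord0) expr0 mul1r => E.
have -> : \prod_j \prod_k BA (u j) (w k) =
    \prod_i BA (u i) (w ord0) * \prod_i \prod_k BA (u i) (wp k).
  by rewrite -big_split; apply: eq_bigr => i _; rewrite big_ord_recl.
have -> : \prod_l (opp_fun w ord0 - opp_fun w (lift ord0 l)) = \prod_k (wp k - w ord0).
  by apply: eq_bigr => l _; rewrite /opp_fun /wp /=; ring.
transitivity (\prod_i BA (u i) (w ord0) * detBA u w *
  (((1 - t) * d) ^+ n.+1 * \prod_i \prod_k BA (u i) (wp k))); last by ring.
rewrite -E -[n.+1.-1]/n -/Q; have -> : vdm (opp_fun w \o lift ord0) = vdm (opp_fun wp) by [].
ring.
Qed.
End Gauged.

(** * Return to the original weights *)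

Theorem mainTheorem10 (R : fieldType) (t a b c d e f : R)
  (ht0 : t != 0) (ha : a != 0) (hb : b != 0) (hc : c != 0) (hd : d != 0)
  (he : e != 0) (hf : f != 0) (ht1 : t != 1)
  (h1 : c * d + a * f = 0) (h2 : t * c * d + b * e = 0)
  (N : nat) (hN : (1 <= N)%N) (u w : 'I_N -> R)
  (hu : injective u) (hw : injective w)
  (hden1 : forall j k : 'I_N, a * t * u j + b * w k != 0)
  (hden2 : forall j k : 'I_N, e * u j + t * f * w k != 0) :
  @ZN R t a b c d e f N u w =
    (\prod_(j < N) ((1 - t) * d * w j)) *
    (\prod_(j < N) \prod_(k < N) ((a * t * u j + b * w k) * (e * u j + t * f * w k))) /
    ((t ^+ 2 * c * d) ^+ (N * N.-1)./2 *
     \prod_(j < N) \prod_(k < N | (j < k)%N) ((u j - u k) * (w k - w j))) *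
    \det (\matrix_(j < N, k < N) ((a * t * u j + b * w k) * (e * u j + t * f * w k))^-1).
Proof.
have gaugeE : gauge [seq w i | i <- enum 'I_N] (nseq N false) = \prod_k w k.
  rewrite -big_enum -(big_map w xpredT id).
  have: size [seq w i | i <- enum 'I_N] = N by rewrite size_map size_enum_ord.
  move: [seq _ | _ <- _] => ws <-; elim: ws => [|y ws IH] /=; first by rewrite big_nil.
  by rewrite big_cons IH.
have vdmE : \prod_(j < N) \prod_(k < N | (j < k)%N) ((u j - u k) * (w k - w j)) =
    vdm u * vdm (fun k => - w k).
  rewrite -big_split; apply: eq_bigr => j _; rewrite -big_split.
  by apply: eq_bigr => k _; rewrite opprK [- w j + _]addrC.
have wE : \prod_(j < N) ((1 - t) * d * w j) = \prod_k w k * ((1 - t) * d) ^+ N.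
  by rewrite big_split /= prodr_const card_ord mulrC.
(* [Zred_det] is free of Vandermonde denominators; distinctness of the [u j] and of the [w k] allows
   dividing by them. *)
have den0 : (t ^+ 2 * c * d) ^+ (N * N.-1)./2 * (vdm u * vdm (fun k => - w k)) != 0.
  rewrite !mulf_neq0 ?expf_neq0 ?mulf_neq0 ?expf_neq0 ?vdm_neq0 //.
  by move=> j k /oppr_inj/hw.
rewrite /ZN Cvec_gauge gaugeE vdmE wE; apply: (mulIf den0).
have /= Zdet := Zred_det ht0 ha he h1 h2 hb hc hd hu hw hden1 hden2.
by rewrite -[LHS]mulrA Zdet [RHS]mulrAC mulfVK // !mulrA.
Qed.
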